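(* Suppose that $\mathrm{zer}(\Phi)\neq\emptyset$, $F$ is $L$-Lipschitz continuous, and $\Phi$ is $\rho$-co-hypomonotone. Let $\kappa\ge0,\hat\kappa\ge0$ satisfy $128[(1+4\kappa)L^2+2\hat\kappa]\rho^2<1$. Let $\{(x^k,y^k,\bar x^k)\}$ be generated by the scheme (GFEG$_+$) described in the context, with $u^0=Fx^0$ and directions $u^k$ satisfying, for all $k\ge1$, $$\|Fx^k-u^k\|^2\le\kappa\|Fx^k-Fy^{k-1}\|^2+\hat\kappa\eta^2\|\hat w^k-(1-\tau_{k-1})w^{k-1}\|^2,$$ and with parameters $$\tau_k:=\frac1{t_k}=\frac1{\mu(k+r)},\qquad\hat\eta_k:=\eta(1-\tau_k),\qquad\beta_k:=-\gamma\tau_k+4\rho(1-\tau_k),$$ where $\mu\in(0,\frac12)$ and $r\ge1+\frac2\mu$ are given, and $$8\rho<\eta<\bar\eta:=\frac1{\sqrt{2(1+4\kappa)L^2+4\hat\kappa}},\qquad\gamma:=\frac{(1-2\mu)\eta}{6}.$$ Then $$\sum_{k=0}^\infty(k+r)^2\|Fx^{k+1}-Fy^k\|^2<+\infty,\qquad\sum_{k=0}^\infty(k+r)^2\|u^k-Fx^k\|^2<+\infty,$$ $$\sum_{k=0}^\infty(k+r)\|y^k-x^k\|^2<+\infty,\qquad\sum_{k=0}^\infty(k+r)\|x^{k+1}-x^k\|^2<+\infty.$$ We also have $$\lim_{k\to\infty}k^2\|Fx^k+\xi^k\|^2=0,\qquad\lim_{k\to\infty}k^2\|y^k-x^k\|^2=0,\qquad\lim_{k\to\infty}k^2\|x^{k+1}-x^k\|^2=0.$$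 Moreover, if $T$ is closed (i.e. $\mathrm{gra}(T)$ is closed), then all three sequences $\{x^k\}$, $\{y^k\}$, and $\{\bar x^k\}$ converge to a solution $x^\star\in\mathrm{zer}(\Phi)$.
   Context: $\mathbb R^p$ carries the standard inner product and Euclidean norm. $F:\mathbb R^p\to\mathbb R^p$ is single-valued, $T:\mathbb R^p\rightrightarrows2^{\mathbb R^p}$ is set-valued, $\Phi:=F+T$, $\mathrm{zer}(\Phi)=\{x:0\in Fx+Tx\}$. For $\rho\ge0$, $\Phi$ is $\rho$-co-hypomonotone if $\langle u-v,x-y\rangle\ge-\rho\|u-v\|^2$ for all $(x,u),(y,v)\in\mathrm{gra}(\Phi)$. $F$ is $L$-Lipschitz continuous if $\|Fx-Fy\|\le L\|x-y\|$ for all $x,y$. Scheme (GFEG$_+$): start from $x^0\in\mathrm{dom}(\Phi)$, $\bar x^0:=x^0$, $\xi^0\in Tx^0$ arbitrary, $y^{-1}=x^{-1}:=x^0$, $u^0:=Fx^0$. With elements $\xi^k\in Tx^k$ put $w^k:=Fx^k+\xi^k$, $\hat w^k:=Fy^{k-1}+\xi^k$, $z^k:=u^k+\xi^k$. For $k\ge0$: $$y^k:=x^k+\tau_k(\bar x^k-x^k)-(\hat\eta_k-\beta_k)z^k,\quad x^{k+1}:=x^k+\tau_k(\bar x^k-x^k)-\eta\hat w^{k+1}+\beta_kz^k,\quad\bar x^{k+1}:=\bar x^k-\gamma z^k,$$ where the second (implicit) line means that $x^{k+1}$ and some $\xi^{k+1}\in Tx^{k+1}$ satisfy the displayed equation with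 $\hat w^{k+1}=Fy^k+\xi^{k+1}$ (this is the element $\xi^{k+1}$ used thereafter). ''Generated by'' means these relations hold for all $k\ge0$. *)

(* Defs.v *)
From HB Require Import structures.
From mathcomp Require Import all_boot all_order all_algebra.
From mathcomp Require Import all_classical all_reals all_analysis.
Set Implicit Arguments.
Unset Strict Implicit.
Unset Printing Implicit Defensive.
Import Order.TTheory GRing.Theory Num.Theory.
Import numFieldNormedType.Exports.
Local Open Scope classical_set_scope.
Local Open Scope ring_scope.

(* The library norm on ['rV[R]_p] is the sup norm, so the Euclidean structure
   of R^p is set up here; both norms induce the same topology. *)
Definition dotp (R : realType) (p : nat) (u v : 'rV[R]_p) : R :=
  \sum_(i < p) u 0 i * v 0 i.

Definition enorm (R : realType) (p : nat) (u : 'rV[R]_p) : R :=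
  Num.sqrt (dotp u u).

(* A set-valued operator is a map ['rV[R]_p -> set 'rV[R]_p]. *)
Section Operators.
Variables (R : realType) (p : nat).
Implicit Types (F : 'rV[R]_p -> 'rV[R]_p) (A T : 'rV[R]_p -> set 'rV[R]_p).

Definition op_add F T : 'rV[R]_p -> set 'rV[R]_p :=
  fun x => [set F x + v | v in T x].

Definition dom A : set 'rV[R]_p := [set x | A x !=set0].

Definition gra A : set ('rV[R]_p * 'rV[R]_p) := [set xu | A xu.1 xu.2].

Definition zer A : set 'rV[R]_p := [set x | A x 0].

Definition lipschitz_continuous (L : R) F : Prop :=
  forall x y, enorm (F x - F y) <= L * enorm (x - y).

Definition co_hypomonotone (rho : R) A : Prop :=
  forall x u y v, gra A (x, u) -> gra A (y, v) ->
    dotp (u - v) (x - y) >= - rho * enorm (u - v) ^+ 2.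

End Operators.

Section Scheme.
Variables (R : realType) (p : nat).
Variables (F : 'rV[R]_p -> 'rV[R]_p) (T : 'rV[R]_p -> set 'rV[R]_p).
Variables (x y xbar u xi : nat -> 'rV[R]_p).

(* y^{k-1}, with the convention y^{-1} = x^0 *)
Definition y_prev (k : nat) : 'rV[R]_p := if k is j.+1 then y j else x 0%N.

Definition w (k : nat) : 'rV[R]_p := F (x k) + xi k.

Definition w_hat (k : nat) : 'rV[R]_p := F (y_prev k) + xi k.

Definition z (k : nat) : 'rV[R]_p := u k + xi k.

(* The step [gfeg_x] is implicit: [w_hat k.+1] involves [xi k.+1], which
   [gfeg_xi] requires to lie in [T (x k.+1)]. *)
Record GFEG_plus (eta gamma : R) (tau eta_hat beta : nat -> R) : Prop := {
  gfeg_dom : dom (op_add F T) (x 0%N);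
  gfeg_xbar0 : xbar 0%N = x 0%N;
  gfeg_u0 : u 0%N = F (x 0%N);
  gfeg_xi : forall k, T (x k) (xi k);
  gfeg_y : forall k,
    y k = x k + tau k *: (xbar k - x k) - (eta_hat k - beta k) *: z k;
  gfeg_x : forall k,
    x k.+1 = x k + tau k *: (xbar k - x k)
             - eta *: w_hat k.+1 + beta k *: z k;
  gfeg_xbar : forall k, xbar k.+1 = xbar k - gamma *: z k
}.

Definition direction_bound (kappa kappa_hat eta : R) (tau : nat -> R) : Prop :=
  forall k, (1 <= k)%N ->
    enorm (F (x k) - u k) ^+ 2 <=
      kappa * enorm (F (x k) - F (y_prev k)) ^+ 2
      + kappa_hat * eta ^+ 2
        * enorm (w_hat k - (1 - tau k.-1) *: w k.-1) ^+ 2.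

End Scheme.

(* The inverse is taken in the extended reals, where [0^-1 = +oo]: when
   [L = kappa_hat = 0] the step size [eta] has no upper bound. *)
Definition eta_bar (R : realType) (L kappa kappa_hat : R) : \bar R :=
  (((Num.sqrt (2 * (1 + 4 * kappa) * L ^+ 2 + 4 * kappa_hat))%:E)^-1)%E.

(* Main.v *)
Require Import Defs.
From HB Require Import structures.
From mathcomp Require Import all_boot all_order all_algebra.
From mathcomp Require Import all_classical all_reals all_analysis.
From mathcomp Require Import ring lra.
Set Implicit Arguments.
Unset Strict Implicit.
Unset Printing Implicit Defensive.
Import Order.TTheory GRing.Theory Num.Theory.
Import numFieldNormedType.Exports.
Local Open Scope classical_set_scope.
Local Open Scope ring_scope.

(** Write t_k = mu (k + r), w^k = F x^k + xi^k, e^k = u^k - F x^k,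
    v^k = x^k - xbar^k, and s = t_(k-1), so that t_k = s + mu and s >= 2.
    The proof is a Lyapunov argument built on the potential
      Q_k = (s^2 (eta/2 - 2 rho) + rho s) |w^k|^2 + s <w^k, v^k>
            + 2 eta s^2 |e^k|^2
    and, for a solution x*, on the energy
      E_k = Q_k + (1 - mu)/(2 gamma) |xbar^k - x*|^2.

    Multiplying the co-hypomonotonicity inequality between x^k and x^(k+1) by
    t_k (t_k - 1) makes the inner products telescope; the choice of beta_k
    cancels the cross term <w^(k+1), z^k>.  The Lipschitz bound and the bound on
    the directions are paid for by D_k = |t_k what^(k+1) - (t_k - 1) w^k|^2,
    with some of it left over because eta is strictly below its upper bound.
    This is [one_step_energy], whence [potential_drop].

    The term (1 - mu) <w^k, v^k> lost by Q_k is recovered from the motion of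
    xbar^k and from the monotonicity inequality against x*.  Only the error
    <e^k, xbar^k - x*> remains; since s^2 |e^k|^2 is dissipated, it costs a
    relative increase of E_k of order 1/s^2, which is summable.  Hence
    ([energy_drop], [energy_descent]) E_k converges and
    s |w^k|^2, s^2 |e^k|^2 and D_k are summable.

    From these, V_k = |v^k|^2 obeys V_(k+1) + V_k / t_k <= V_k + eps_k with
    summable eps_k, so V_k converges while V_k / t_k is summable; as 1/t_k is
    not summable, V_k -> 0.
    The same principle applied to Q_k + (2/eta) V_k, which dominates
    s^2 |w^k|^2, gives k^2 |w^k|^2 -> 0, and the estimates on the steps are
    linear consequences.

    Finally E_k and Q_k both converge, so |xbar^k - x*| converges for every
    solution x*.  A cluster point of xbar^k is a solution, because x^k - xbar^k
    and w^k tend to 0 and the graph of T is closed; taking x* to be that point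
    forces convergence of the whole sequence. *)

(** * Euclidean inner product and squared norm *)
Section Euclidean.
Variables (R : realType) (p : nat).
Implicit Types (a b c : 'rV[R]_p) (k : R).

Lemma dotpC a b : dotp a b = dotp b a.
Proof. by apply: eq_bigr => i _; rewrite mulrC. Qed.

Lemma dotpDl a b c : dotp (a + b) c = dotp a c + dotp b c.
Proof. by rewrite -big_split; apply: eq_bigr => i _; rewrite mxE mulrDl. Qed.

Lemma dotpZl k a b : dotp (k *: a) b = k * dotp a b.
Proof. by rewrite mulr_sumr; apply: eq_bigr => i _; rewrite mxE mulrA. Qed.

Lemma dotpNl a b : dotp (- a) b = - dotp a b.
Proof. by rewrite -scaleN1r dotpZl mulN1r. Qed.

Lemma dotpDr a b c : dotp a (b + c) = dotp a b + dotp a c.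
Proof. by rewrite dotpC dotpDl !(dotpC a). Qed.

Lemma dotpZr k a b : dotp a (k *: b) = k * dotp a b.
Proof. by rewrite dotpC dotpZl (dotpC a). Qed.

Lemma dotpNr a b : dotp a (- b) = - dotp a b.
Proof. by rewrite dotpC dotpNl (dotpC a). Qed.

Definition dotp_lin := (dotpDl, dotpDr, dotpZl, dotpZr, dotpNl, dotpNr).

Definition sqn a : R := dotp a a.

Lemma sqn_ge0 a : 0 <= sqn a.
Proof. by apply: sumr_ge0 => i _; rewrite -expr2 sqr_ge0. Qed.

Lemma enorm2E a : enorm a ^+ 2 = sqn a.
Proof. exact: sqr_sqrtr (sqn_ge0 a). Qed.

Lemma sqnZ k a : sqn (k *: a) = k ^+ 2 * sqn a.
Proof. by rewrite /sqn !dotp_lin; ring. Qed.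

Lemma sqnN a : sqn (- a) = sqn a.
Proof. by rewrite /sqn !dotp_lin; ring. Qed.

Lemma sqnD a b : sqn (a + b) = sqn a + 2 * dotp a b + sqn b.
Proof. by rewrite /sqn !dotp_lin (dotpC b a); ring. Qed.

Lemma sqnD_le a b : sqn (a + b) <= 2 * sqn a + 2 * sqn b.
Proof.
have := sqn_ge0 (a - b); rewrite !sqnD sqnN !dotp_lin; lra.
Qed.

Lemma dotp_young k a b : 0 < k ->
  `|dotp a b| <= k / 2 * sqn a + (2 * k)^-1 * sqn b.
Proof.
move=> k0.
have h1 := sqn_ge0 (k *: a - b); have h2 := sqn_ge0 (k *: a + b).
rewrite !sqnD sqnN sqnZ !dotp_lin in h1 h2.
have -> : k / 2 * sqn a + (2 * k)^-1 * sqn b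
        = (k ^+ 2 * sqn a + sqn b) / (2 * k) by field; lra.
have k2 : 0 < 2 * k by lra.
by rewrite ler_norml -mulNr ler_pdivrMr // ler_pdivlMr //; lra.
Qed.

Lemma coord_sqr_le a (i : 'I_p) : a 0 i ^+ 2 <= sqn a.
Proof.
rewrite /sqn /dotp (bigD1 i) //= expr2 lerDl.
by apply: sumr_ge0 => j _; rewrite -expr2 sqr_ge0.
Qed.

End Euclidean.

(** * The vector inequality behind one step *)
Section Energy.
Variables (R : realType) (p : nat).

(** The coefficient of |w^k|^2 in the potential, at s = t_(k-1).  Its leading
    term eta/2 - 2 rho stays above eta/4 because 8 rho < eta. *)
Definition energy_weight (eta rho s : R) : R :=
  s ^+ 2 * (eta / 2 - 2 * rho) + rho * s.

(** The hypotheses are the scheme multiplied by [t], so that no inverse of [t]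
    occurs: [D] is t^2 |wh - (1 - 1/t) w|^2.  The inequality is an exact
    identity plus four nonnegative terms: the monotonicity inequality times
    t (t - 1), the combined error bound [herr] times eta/2, the square that
    absorbs the cross term 4 rho <e, t wp - (t - 1) w>, and the slack
    eta/2 - 4 rho of the condition on [eta]. *)
Lemma one_step_energy (eta rho gam L kap kaph t : R)
    (w wp wh e ep v vp : 'rV[R]_p) :
  0 <= rho -> 8 * rho <= eta -> 1 <= t ->
  0 <= kap ->  0 <= kaph ->
  (2 * (1 + 4 * kap) * L ^+ 2 + 4 * kaph) * eta ^+ 2 <= 1 ->
  let D := sqn (t *: wh - (t - 1) *: w) in
  t *: vp = (t - 1) *: v - (t * eta) *: wh
            + ((t - 1) * (4 * rho + gam)) *: (w + e) ->
  - rho * t * sqn (wp - w) <=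
    dotp (wp - w)
         (- v - (t * eta) *: wh + (4 * rho * (t - 1) - gam) *: (w + e)) ->
  t ^+ 2 * sqn (wp - wh) <=
    L ^+ 2 * eta ^+ 2 * sqn (t *: wh - (t - 1) *: (w + e)) ->
  t ^+ 2 * sqn ep <= kap * (t ^+ 2 * sqn (wp - wh)) + kaph * eta ^+ 2 * D ->
  energy_weight eta rho t * sqn wp + t * dotp wp vp + 2 * eta * t ^+ 2 * sqn ep
  + eta / 2 * (1 - (2 * (1 + 4 * kap) * L ^+ 2 + 4 * kaph) * eta ^+ 2) * D
  <= (energy_weight eta rho (t - 1) + gam * (t - 1)) * sqn w + (t - 1) * dotp w v
     + eta * (t - 1) ^+ 2 * sqn e + gam * (t - 1) * dotp e w.
Proof.
move=> rho0 rhoe t1 kap0 kaph0 hM D hv hmono hLip hdir.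
set M := _ + 4 * kaph in hM *.
have eta0 : 0 <= eta by lra.
have hL2 : 0 <= L ^+ 2 * eta ^+ 2 by rewrite mulr_ge0 ?sqr_ge0.
have hLip' : t ^+ 2 * sqn (wp - wh) <=
    2 * (L ^+ 2 * eta ^+ 2) * (D + (t - 1) ^+ 2 * sqn e).
  apply: (le_trans hLip); rewrite (mulrC 2) -(mulrA _ 2); apply: ler_wpM2l => //.
  have -> : t *: wh - (t - 1) *: (w + e) =
    (t *: wh - (t - 1) *: w) + (- (t - 1)) *: e.
    by rewrite scalerDr scaleNr opprD addrA.
  by apply: (le_trans (sqnD_le _ _)); rewrite sqnZ sqrrN mulrDr.
have hsq := sqn_ge0 (t *: wp - (t - 1) *: w - (2 * (t - 1)) *: e).
have e0 := sqn_ge0 e.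
(* [4 * kap] copies of the Lipschitz error buy four copies of the direction
   error at the next step, twice what the telescoping of the latter needs. *)
have herr : t ^+ 2 * sqn (wp - wh) + 4 * t ^+ 2 * sqn ep <=
    M * eta ^+ 2 * D + (t - 1) ^+ 2 * sqn e.
  have h1 : (1 + 4 * kap) * (t ^+ 2 * sqn (wp - wh)) <=
     (1 + 4 * kap) * (2 * (L ^+ 2 * eta ^+ 2) * (D + (t - 1) ^+ 2 * sqn e)).
    by apply: ler_wpM2l hLip'; lra.
  have h2 : 0 <= (1 - 2 * (1 + 4 * kap) * L ^+ 2 * eta ^+ 2)
                 * ((t - 1) ^+ 2 * sqn e).
    apply: mulr_ge0; last by rewrite mulr_ge0 ?sqr_ge0.
    have : 0 <= kaph * eta ^+ 2 by rewrite mulr_ge0 ?sqr_ge0.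
    by move: hM; rewrite /M; lra.
  by rewrite /M; lra.
have h1 : 0 <= eta / 2 * (M * eta ^+ 2 * D + (t - 1) ^+ 2 * sqn e
   - (t ^+ 2 * sqn (wp - wh) + 4 * t ^+ 2 * sqn ep)).
  by apply: mulr_ge0; lra.
have h2 : 0 <= (t - 1) * (dotp (wp - w)
         (- v - (t * eta) *: wh + (4 * rho * (t - 1) - gam) *: (w + e)) +
     rho * t * sqn (wp - w)).
  by apply: mulr_ge0; lra.
have h3 : 0 <= rho * sqn (t *: wp - (t - 1) *: w - (2 * (t - 1)) *: e).
  exact: mulr_ge0.
have h4 : 0 <= (eta / 2 - 4 * rho) * ((t - 1) ^+ 2 * sqn e).
  by apply: mulr_ge0; [lra | rewrite mulr_ge0 ?sqr_ge0].
have htv : t * dotp wp vp = dotp wp (t *: vp) by rewrite dotpZr.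
rewrite htv hv.
move: h1 h2 h3 h4; rewrite /energy_weight /D /sqn !dotp_lin.
rewrite ?(dotpC wp w) ?(dotpC wh w) ?(dotpC wh wp) ?(dotpC e w) ?(dotpC e wp).
rewrite ?(dotpC e wh) ?(dotpC v w) ?(dotpC v wp).
generalize (dotp w w) (dotp w wp) (dotp w wh) (dotp w e) (dotp w v) (dotp wp wp).
generalize (dotp wp wh) (dotp wp e) (dotp wp v) (dotp wh wh) (dotp wh e).
generalize (dotp e e) (dotp ep ep).
clear; move: M => M *.
lra.
Qed.
End Energy.

(** * Series with bounded partial sums *)
Section Summability.
Variable R : realType.
Implicit Types (f g a b s eps T : nat -> R).

(** For nonnegative terms this is convergence of the series; stated as a bound,
    it passes through one-sided comparisons with no condition on signs. *)
Definition bounded_series f := exists B, forall n, series f n <= B.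

Lemma bounded_series_le f g :
  (forall k, f k <= g k) -> bounded_series g -> bounded_series f.
Proof.
by move=> fg [B hB]; exists B => n; apply: le_trans (hB n); apply: ler_sum.
Qed.

Lemma bounded_seriesD f g : bounded_series f -> bounded_series g ->
  bounded_series (fun k => f k + g k).
Proof.
move=> [B hB] [C hC]; exists (B + C) => n.
by rewrite /series /= big_split lerD ?hB ?hC.
Qed.

Lemma bounded_seriesZ c f : 0 <= c -> bounded_series f ->
  bounded_series (fun k => c * f k).
Proof.
by move=> c0 [B hB]; exists (c * B) => n;
  rewrite /series /= -mulr_sumr ler_wpM2l ?hB.
Qed.

Lemma bounded_seriesS f : bounded_series f -> bounded_series (fun k => f k.+1).
Proof.
move=> [B hB]; exists (B - f 0%N) => n.
by have := hB n.+1; rewrite /series /= big_nat_recl //; lra.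
Qed.

Lemma bounded_series_unS f :
  bounded_series (fun k => f k.+1) -> bounded_series f.
Proof.
move=> [B hB]; exists (`|f 0%N| + `|B|) => -[|n].
  by rewrite /series /= big_geq // addr_ge0.
rewrite /series /= big_nat_recl //; apply: lerD (ler_norm _) _.
exact: le_trans (hB n) (ler_norm _).
Qed.

Lemma bounded_series_shift N f :
  bounded_series (fun k => f (N + k)%N) -> bounded_series f.
Proof.
elim: N f => [//|N IH] f h; apply: bounded_series_unS.
by apply: IH; apply: bounded_series_le h => k; rewrite addSn.
Qed.

Lemma bounded_series_cvg f :
  (forall k, 0 <= f k) -> bounded_series f -> cvgn (series f).
Proof.
move=> f0 [B hB]; apply: nondecreasing_is_cvgn.
  by apply/nondecreasing_seqP => n; rewrite seriesSr lerDl.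
by exists B => _ [n _ <-].
Qed.

Lemma bounded_series_cvg0 f :
  (forall k, 0 <= f k) -> bounded_series f -> f @ \oo --> (0 : R).
Proof. by move=> f0 /(bounded_series_cvg f0)/cvg_series_cvg_0. Qed.

Lemma bounded_series_eseries f : (forall k, 0 <= f k) -> bounded_series f ->
  (\sum_(0 <= k <oo) (f k)%:E < +oo)%E.
Proof.
move=> f0 [B hB]; apply: (@le_lt_trans _ _ B%:E); last exact: ltry.
apply: lime_le; first by apply: is_cvg_nneseries => k _ _; rewrite lee_fin.
by apply: nearW => n; rewrite sumEFin lee_fin; exact: hB.
Qed.

(** Subtracting the partial sums of [eps] from [a] leaves a nonincreasing
    sequence that is bounded below. *)
Lemma quasi_descent a s eps m :
  (forall k, 0 <= s k) -> (forall k, 0 <= eps k) -> bounded_series eps ->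
  (forall k, m <= a k) -> (forall k, a k.+1 + s k <= a k + eps k) ->
  cvgn a /\ bounded_series s.
Proof.
move=> s0 e0 sume am desc.
have [B hB] := sume.
have acc n : a n + series s n <= a 0%N + series eps n.
  elim: n => [|n IH]; first by rewrite /series /= !big_geq.
  by have := desc n; rewrite !seriesSr; lra.
split; last first.
  by exists (a 0%N + B - m) => n; have := acc n; have := hB n; have := am n; lra.
have -> : a = (fun n => (a n - series eps n) + series eps n).
  by apply/funext => n; rewrite subrK.
apply: is_cvgD; last exact: bounded_series_cvg.
apply: nonincreasing_is_cvgn.
  apply/nonincreasing_seqP => n; have := desc n; have := s0 n.
  rewrite seriesSr; lra.
by exists (m - B) => _ [n _ <-]; have := am n; have := hB n; lra.
Qed.

(** 1 + eps_k <= exp(eps_k), so the growth factors multiply to at most the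
    exponential of the bound on the series of [eps]. *)
Lemma discrete_gronwall a eps :
  (forall k, 0 <= a k) -> bounded_series eps ->
  (forall k, a k.+1 <= (1 + eps k) * a k) -> exists B, forall k, a k <= B.
Proof.
move=> a0 [B hB] ha; exists (expR B * a 0%N) => n.
apply: (@le_trans _ _ (expR (series eps n) * a 0%N)); last first.
  by rewrite ler_wpM2r // ler_expR.
elim: n => [|n IH]; first by rewrite /series /= big_geq // expR0 mul1r.
apply: (le_trans (ha n)); rewrite seriesSr (addrC (series _ _)) expRD -mulrA.
apply: (@le_trans _ _ (expR (eps n) * a n)).
  by apply: ler_wpM2r => //; exact: expR_ge1Dx.
by rewrite ler_wpM2l // expR_ge0.
Qed.

(** 1/T_(k+1)^2 <= 1/(T_k T_(k+1)) = (1/T_k - 1/T_(k+1)) / d telescopes. *)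
Lemma inv_sqr_bounded_series T d : 0 < d -> (forall k, 0 < T k) ->
  (forall k, T k.+1 = T k + d) -> bounded_series (fun k => (T k ^+ 2)^-1).
Proof.
move=> d0 T0 TS; apply: bounded_series_unS.
apply: (@bounded_series_le _ (fun k => d^-1 * ((T k)^-1 - (T k.+1)^-1))).
  move=> k; have h0 := T0 k; have h1 := T0 k.+1.
  have -> : d^-1 * ((T k)^-1 - (T k.+1)^-1) = (T k * T k.+1)^-1.
    by rewrite TS; rewrite TS in h1; field; lra.
  rewrite lef_pV2 ?posrE ?mulr_gt0 ?exprn_gt0 // expr2 ler_wpM2r ?(ltW h1) //.
  by rewrite TS; lra.
apply: bounded_seriesZ; first by rewrite invr_ge0 ltW.
exists (T 0%N)^-1 => n.
rewrite (_ : series _ n = (T 0%N)^-1 - (T n)^-1); last first.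
  elim: n => [|n IH]; first by rewrite /series /= big_geq // subrr.
  by rewrite seriesSr IH; lra.
by rewrite gerBl invr_ge0 ltW.
Qed.

(** A positive limit of [b] would make the harmonic series converge. *)
Lemma cvg_harmonic_weight b T C : (forall k, 0 <= b k) ->
  (forall k, 0 < T k) -> (forall k, T k <= C * k.+1%:R) ->
  bounded_series (fun k => b k / T k) -> cvgn b -> b @ \oo --> (0 : R).
Proof.
move=> b0 T0 TC sumb; set l := limn b => cb.
suff l00 : l = 0 by rewrite -l00.
have l0 : 0 <= l.
  by apply: (cvgr_to_ge cb); apply: nearW.
apply/eqP; rewrite eq_le l0 andbT leNgt; apply/negP => lgt0.
have C0 : 0 < C.
  by have := lt_le_trans (T0 0%N) (TC 0%N); rewrite mulr1.
apply: (@dvg_harmonic R); apply: bounded_series_cvg.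
  by move=> k; rewrite /harmonic /= invr_ge0.
have : \forall k \near \oo, l / 2 < b k.
  by apply: (cvgr_gt _ cb); lra.
case=> N _ hN; apply: (@bounded_series_shift N).
apply: (@bounded_series_le _ (fun k => 2 * C / l * (b (N + k)%N / T (N + k)%N))).
  move=> k; have := hN (N + k)%N (leq_addr _ _) => /= hb.
  have hT := TC (N + k)%N; have hT0 := T0 (N + k)%N.
  rewrite /harmonic /=.
  set n1 := (N + k).+1%:R in hT *.
  have n0 : 0 < n1 by rewrite /n1 ltr0n.
  rewrite -ler_pdivrMl; last by rewrite divr_gt0 // mulr_gt0.
  rewrite ler_pdivlMr // (_ : _ * _ * _ = (l / 2) * (T (N + k)%N / (C * n1))).
    apply: (le_trans _ (ltW hb)); rewrite ger_pMr ?divr_gt0 //.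
    by rewrite ler_pdivrMr ?mul1r ?mulr_gt0.
  by field; rewrite !lt0r_neq0.
apply: bounded_seriesZ; first by rewrite divr_ge0 ?mulr_ge0 // ltW.
elim: N {hN} => [//|N /bounded_seriesS]; apply: bounded_series_le => k.
by rewrite addSnnS.
Qed.

Lemma cvg0_le f g : (forall k, 0 <= f k <= g k) ->
  g @ \oo --> (0 : R) -> f @ \oo --> (0 : R).
Proof.
by move=> fg; apply: squeeze_cvgr (cvg_cst _); exact: nearW.
Qed.

Lemma cvg0D f g : f @ \oo --> (0 : R) -> g @ \oo --> (0 : R) ->
  (fun k => f k + g k) @ \oo --> (0 : R).
Proof. by move=> hf hg; rewrite -[0]addr0; exact: cvgD. Qed.

Lemma cvg0Z c f : f @ \oo --> (0 : R) -> (fun k => c * f k) @ \oo --> (0 : R).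
Proof. by move=> hf; rewrite -(mulr0 c); apply: cvgM => //; exact: cvg_cst. Qed.

End Summability.

(** * Real inequalities for the potential and the energy *)
Section Potential.
Variable R : realType.

(** In this part [W], [Er], [X] stand for |w|^2, |e|^2, |xbar - x*|^2, [Z] for
    |w + e|^2, and [c], [cew], [cwd], [ced] for <w, x - xbar>, <e, w>,
    <w, xbar - x*>, <e, xbar - x*>, [Y] for the dissipated multiple of D_k;
    a final [p] marks the next iterate.
    Here s = t_(k-1), so that the coefficients at [t - 1] produced by one step
    lie below those of the potential at [s] by a gap of order [s]; this gap
    pays for the terms in [gam]. *)
Lemma potential_drop_real (eta rho mu gam s t W Wp Er Erp c cp cew Y : R) :
  0 <= rho -> 8 * rho < eta -> 0 < mu < 1 / 2 -> 2 <= s ->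
  gam = (1 - 2 * mu) * eta / 6 -> 0 <= W -> 0 <= Er ->
  `|cew| <= (W + Er) / 2 ->
  t = s + mu ->
  energy_weight eta rho t * Wp + t * cp + 2 * eta * t ^+ 2 * Erp + Y
  <= (energy_weight eta rho (t - 1) + gam * (t - 1)) * W + (t - 1) * c
     + eta * (t - 1) ^+ 2 * Er + gam * (t - 1) * cew ->
  energy_weight eta rho t * Wp + t * cp + 2 * eta * t ^+ 2 * Erp + Y
  + (1 - mu) * (rho + eta / 4 * s) * W + 23 / 24 * eta * s ^+ 2 * Er
  + (1 - mu) * c
  <= energy_weight eta rho s * W + s * c + 2 * eta * s ^+ 2 * Er.
Proof.
move=> rho0 rhoe /andP[mu0 mu1] s2 gamE W0 Er0 hcew tE hstep.
have eta0 : 0 < eta by lra.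
have gam0 : 0 <= gam by rewrite gamE !mulr_ge0 //; lra.
have gams0 : 0 <= gam * (t - 1) by apply: mulr_ge0 => //; rewrite tE; lra.
have hc : gam * (t - 1) * cew <= gam * (t - 1) * ((W + Er) / 2).
  by apply: ler_wpM2l => //; apply: le_trans hcew; exact: ler_norm.
have cW : 0 <= energy_weight eta rho s - energy_weight eta rho (t - 1)
               - 3 / 2 * gam * (t - 1)
               - (1 - mu) * (rho + eta / 4 * s).
  have h1 : 0 <= (1 - mu) * ((2 * s + mu - 1) * (eta / 4 - 2 * rho)).
    by rewrite !mulr_ge0 //; lra.
  have h2 : 0 <= eta / 4 * (mu * (s + mu - 1)) by rewrite !mulr_ge0 //; lra.
  by rewrite /energy_weight tE gamE; lra.
have cE : 0 <= 2 * eta * s ^+ 2 - eta * (t - 1) ^+ 2 - gam * (t - 1) / 2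
               - 23 / 24 * eta * s ^+ 2.
  have h1 : 0 <= eta * (mu * (s - 1)) by rewrite !mulr_ge0 //; lra.
  have h2 : 0 <= eta * (s * (s - 2)) by rewrite !mulr_ge0 //; lra.
  have h3 : 0 <= eta * ((1 / 2 - mu) * (s - 1)) by rewrite !mulr_ge0 //; lra.
  have h4 : 0 <= eta * (mu * (1 / 2 - mu)) by rewrite !mulr_ge0 //; lra.
  have h5 : 0 <= eta * s by rewrite !mulr_ge0 //; lra.
  by rewrite tE gamE; nra.
have hW := mulr_ge0 cW W0; have hE := mulr_ge0 cE Er0.
by rewrite tE in hstep hc hW hE *; lra.
Qed.

(** The weight (1 - mu) / (2 gam) is the one for which the motion of xbar
    turns (1 - mu) c into (1 - mu) (c + cwd), to which the monotonicity
    inequality against the solution applies.  Young's inequality with weight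
    eta s^2 on [ced] gives the factor 1 + 1/(2 s^2). *)
Lemma energy_drop_real (eta rho mu gam s W Er c X Xp cwd ced Z Q Qp Y : R) :
  0 <= rho -> 8 * rho < eta -> 0 < mu < 1 / 2 -> 2 <= s ->
  gam = (1 - 2 * mu) * eta / 6 -> 0 <= W -> 0 <= Er ->
  Qp + Y + (1 - mu) * (rho + eta / 4 * s) * W + 23 / 24 * eta * s ^+ 2 * Er
  + (1 - mu) * c <= Q ->
  X / eta <= Q + (1 - mu) / (2 * gam) * X ->
  Xp = X - 2 * gam * (cwd + ced) + gam ^+ 2 * Z ->
  Z <= 2 * W + 2 * Er ->
  - rho * W <= c + cwd ->
  `|ced| <= (eta * s ^+ 2) / 2 * Er + (2 * (eta * s ^+ 2))^-1 * X ->
  Qp + (1 - mu) / (2 * gam) * Xp + Y + eta / 12 * s * W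
  + eta / 4 * s ^+ 2 * Er
  <= (1 + 2^-1 * (s ^+ 2)^-1) * (Q + (1 - mu) / (2 * gam) * X).
Proof.
move=> rho0 rhoe /andP[mu0 mu1] s2 gamE W0 Er0.
have eta0 : 0 < eta by lra.
have h5 : 0 <= eta * (s - 2) by apply: mulr_ge0; lra.
have h7 : 0 <= (1 / 2 - mu) * eta by apply: mulr_ge0; lra.
have h8 : 0 <= mu * eta by apply: mulr_ge0; lra.
have h9 : 0 <= (1 / 2 - mu) * (mu * eta) by apply: mulr_ge0; lra.
move=> hQ hX -> hZ hopt hced.
have gam0 : 0 < gam by rewrite gamE divr_gt0 ?mulr_gt0 //; lra.
have s20 : 0 < s ^+ 2 by rewrite exprn_gt0 //; lra.
have X0 : (2 * (eta * s ^+ 2))^-1 * X <=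
   2^-1 * (s ^+ 2)^-1 * (Q + (1 - mu) / (2 * gam) * X).
  have -> : (2 * (eta * s ^+ 2))^-1 * X = 2^-1 * (s ^+ 2)^-1 * (X / eta).
    by field; lra.
  by apply: ler_wpM2l hX; rewrite mulr_ge0 ?invr_ge0 // ltW.
have hC : (1 - mu) / (2 * gam) * (X - 2 * gam * (cwd + ced) + gam ^+ 2 * Z) =
  (1 - mu) / (2 * gam) * X - (1 - mu) * (cwd + ced) + (1 - mu) * (gam / 2) * Z.
  by field; lra.
rewrite hC.
set E := Q + _ in X0 *.
have EE : E = Q + (1 - mu) / (2 * gam) * X by [].
have h1 : (1 - mu) * (gam / 2) * Z <= (1 - mu) * (gam / 2) * (2 * W + 2 * Er).
  by apply: ler_wpM2l hZ; rewrite mulr_ge0 //; lra.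
have h2 : 0 <= (1 - mu) * (c + cwd + rho * W) by rewrite mulr_ge0 //; lra.
have hX0 := le_trans (normr_ge0 _) hced.
have h3 : - ((1 - mu) * ced) <=
   (eta * s ^+ 2) / 2 * Er + (2 * (eta * s ^+ 2))^-1 * X.
  apply: le_trans hced; apply: le_trans (ler_norm _) _.
  by rewrite normrN normrM ger0_norm; [rewrite ler_piMl //; lra | lra].
have cW : 0 <= (1 - mu) * (eta / 4 * s - gam) - eta / 12 * s.
  have h6 : 0 <= (1 / 2 - mu) * (eta * (s - 2)) by rewrite mulr_ge0 //; lra.
  by rewrite gamE; lra.
have cE : 0 <= 23 / 24 * eta * s ^+ 2 - (1 - mu) * gam - eta * s ^+ 2 / 2
    - eta / 4 * s ^+ 2.
  have h6 : 0 <= eta * (s - 2) ^+ 2 by rewrite mulr_ge0 ?sqr_ge0 //; lra.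
  by rewrite gamE; lra.
have hW := mulr_ge0 cW W0; have hE := mulr_ge0 cE Er0.
clear hC hced hX hX0; clearbody E.
move: ((1 - mu) / (2 * gam)) EE => C EE.
move: ((2 * (eta * s ^+ 2))^-1 * X) X0 h3 => I1 X0 h3.
move: (2^-1 * (s ^+ 2)^-1) X0 => I2 X0.
by lra.
Qed.

(** Since c >= - rho W - cwd, only the product s cwd can be negative; the two
    squares absorb it because (1 - mu) / (2 gam) >= 3 / eta, which is where
    the smallness of [gam] enters. *)
Lemma energy_coercive_real (eta rho mu gam s W Er c X cwd : R) :
  0 <= rho -> 8 * rho < eta -> 0 < mu < 1 / 2 -> 0 < s ->
  gam = (1 - 2 * mu) * eta / 6 -> 0 <= W -> 0 <= X ->
  - rho * W <= c + cwd ->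
  `|s * cwd| <= eta / 4 / 2 * (s ^+ 2 * W) + (2 * (eta / 4))^-1 * X ->
  eta / 8 * s ^+ 2 * W + 2 * eta * s ^+ 2 * Er + X / eta <=
  energy_weight eta rho s * W + s * c + 2 * eta * s ^+ 2 * Er
  + (1 - mu) / (2 * gam) * X.
Proof.
move=> rho0 rhoe /andP[mu0 mu1] s0 gamE W0 X0 hopt hcwd.
have eta0 : 0 < eta by lra.
have hC : 3 / eta * X <= (1 - mu) / (2 * gam) * X.
  apply: ler_wpM2r => //; rewrite gamE -subr_ge0.
  have -> : (1 - mu) / (2 * ((1 - 2 * mu) * eta / 6)) - 3 / eta =
     3 * mu / ((1 - 2 * mu) * eta) by field; lra.
  by rewrite divr_ge0 ?mulr_ge0 //; lra.
rewrite (_ : (2 * (eta / 4))^-1 * X = 2 / eta * X) in hcwd; last by field; lra.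
have h1 : 0 <= s * (c + cwd + rho * W) by rewrite mulr_ge0 //; lra.
have h2 := le_trans (ler_norm _) hcwd.
have h3 : 0 <= (eta / 4 - 2 * rho) * (s ^+ 2 * W).
  by rewrite !mulr_ge0 ?sqr_ge0 //; lra.
by rewrite /energy_weight; lra.
Qed.

End Potential.

(** * Squared Euclidean distance and the topology of row vectors *)
Section Topology.
Variables (R : realType) (p : nat).
Implicit Types (l : 'rV[R]_p) (a : nat -> 'rV[R]_p).

(** Row vectors carry the sup norm, which lies between |.| / sqrt p and |.|. *)
Lemma nbhs_sqnP l (A : set 'rV[R]_p) :
  nbhs l A <-> exists2 e : R, 0 < e & forall b, sqn (b - l) < e -> A b.
Proof.
split=> [|[e e0 he]].
  move/nbhs_ballP => [e /= e0 he]; exists (e ^+ 2); first by rewrite exprn_gt0.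
  move=> b hb; apply: he; split=> // i j; rewrite /ball /= (ord1 i).
  rewrite -(ltr_pXn2r (ltn0Sn 1)) ?nnegrE ?(ltW e0) //.
  apply: le_lt_trans hb; apply: le_trans (coord_sqr_le _ j).
  by rewrite real_normK ?num_real // !mxE -sqrrN opprB.
apply/nbhs_ballP; pose d : R := Num.min 1 (e / p.+1%:R).
have d0 : 0 < d by rewrite lt_min ltr01 divr_gt0.
exists d => // b [_ hb]; apply: he.
apply: (@le_lt_trans _ _ (p%:R * d)).
  rewrite mulr_natl -[X in _ *+ X]card_ord -sumr_const; apply: ler_sum => i _.
  have := hb 0 i; rewrite /ball /= !mxE distrC => hbi.
  rewrite -expr2 -real_normK ?num_real // expr2.
  apply: (@le_trans _ _ (1 * `|b 0 i - l 0 i|)).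
    apply: ler_wpM2r => //; apply: (le_trans (ltW hbi)).
    by rewrite /d ge_min lexx.
  by rewrite mul1r ltW.
have : p.+1%:R * d <= e.
  by rewrite mulrC -ler_pdivlMr // /d ge_min lexx orbT.
by rewrite -natr1; lra.
Qed.

Lemma cvg_sqn a l : (fun k => sqn (a k - l)) @ \oo --> (0 : R) -> a @ \oo --> l.
Proof.
move=> ha A /nbhs_sqnP[e e0 he].
case: (cvgr_lt _ ha _ e0) => N _ hN; exists N => // k /hN; exact: he.
Qed.

(** The sequence stays in a box, which is compact. *)
Lemma sqn_bounded_cluster a l B : (forall k, sqn (a k - l) <= B) ->
  exists m, forall e N, 0 < e -> exists2 k, (N <= k)%N & sqn (a k - m) < e.
Proof.
move=> hB; pose K := [set b : 'rV[R]_p | forall i,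
  `[l 0 i - (B + 1), l 0 i + (B + 1)]%classic (b ord0 i)].
have cK : compact K.
  apply: (@rV_compact R p (fun i => `[l 0 i - (B + 1), l 0 i + (B + 1)]%classic)).
  by move=> i; exact: segment_compact.
have [] := cK (a @ \oo) _.
  exists 0%N => // k _ i /=.
  have B0 : 0 <= B := le_trans (sqn_ge0 _) (hB k).
  have h : (a k 0 i - l 0 i) ^+ 2 <= B.
    by apply: le_trans (hB k); have := coord_sqr_le (a k - l) i; rewrite !mxE.
  by rewrite in_itv /=; apply/andP; split; nra.
move=> m [_ hm]; exists m => e N e0.
have hA : (a @ \oo) (a @` [set k | (N <= k)%N]) by exists N => // k; exists k.
have hb : nbhs m [set b | sqn (b - m) < e] by apply/nbhs_sqnP; exists e.
by have [_ [[k kN <-] hk]] := hm _ _ hA hb; exists k.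
Qed.

End Topology.


(** * Energy decrease along the scheme *)
Section Scheme.
Variables (R : realType) (p : nat).
Variables (F : 'rV[R]_p -> 'rV[R]_p) (T : 'rV[R]_p -> set 'rV[R]_p).
Variables (L rho kappa kappa_hat mu r eta gamma : R).
Variables (tau eta_hat beta : nat -> R).
Variables (x y xbar u xi : nat -> 'rV[R]_p).
Hypotheses (hF : lipschitz_continuous L F) (hrho : 0 <= rho).
Hypothesis hPhi : co_hypomonotone rho (op_add F T).
Hypotheses (hkappa : 0 <= kappa) (hkappa_hat : 0 <= kappa_hat).
Hypotheses (hmu : 0 < mu < 1 / 2) (hr : 1 + 2 / mu <= r).
Hypothesis heta : 8 * rho < eta.
Hypothesis hM : (2 * (1 + 4 * kappa) * L ^+ 2 + 4 * kappa_hat) * eta ^+ 2 < 1.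
Hypothesis hgamma : gamma = (1 - 2 * mu) * eta / 6.
Hypothesis htau : forall k, tau k = 1 / (mu * (k%:R + r)).
Hypothesis heta_hat : forall k, eta_hat k = eta * (1 - tau k).
Hypothesis hbeta :
  forall k, beta k = - gamma * tau k + 4 * rho * (1 - tau k).
Hypothesis hgen : GFEG_plus F T x y xbar u xi eta gamma tau eta_hat beta.
Hypothesis hu : direction_bound F x y u xi kappa kappa_hat eta tau.

(** This is t_(k-1), so that t_k is [tp k.+1]. *)
Definition tp k : R := mu * (k%:R + r - 1).
Let W k := Defs.w F x xi k.
Let Wh k := w_hat F x y xi k.
Definition err k := u k - F (x k).
Definition gap k := x k - xbar k.
Let D k := sqn (tp k.+1 *: Wh k.+1 - (tp k.+1 - 1) *: W k).

Let eta_gt0 : 0 < eta.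
Proof. by apply: le_lt_trans heta; rewrite mulr_ge0. Qed.
Let mu_gt0 : 0 < mu. Proof. by case/andP: hmu. Qed.
Let mu_lt : mu < 1 / 2. Proof. by case/andP: hmu. Qed.
Let gamma_gt0 : 0 < gamma.
Proof. by have h := mu_lt; rewrite hgamma divr_gt0 ?mulr_gt0 //; lra. Qed.

Ltac scheme_lra := have := hrho; have := heta; have := eta_gt0; have := mu_gt0;
  have := mu_lt; have := gamma_gt0; lra.

Let tpS k : tp k.+1 = tp k + mu.
Proof. by rewrite /tp -natr1; ring. Qed.

Let tp_ge2 k : 2 <= tp k.
Proof.
have h : 2 / mu <= k%:R + r - 1 by have := ler0n R k; have := hr; lra.
by rewrite /tp mulrC -ler_pdivrMr.
Qed.

Let tp_gt0 k : 0 < tp k. Proof. by have := tp_ge2 k; lra. Qed.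

Let tauE k : tau k = (tp k.+1)^-1.
Proof. by rewrite htau /tp -natr1 div1r; congr (_ * _)^-1; ring. Qed.

Let zE k : z u xi k = W k + err k.
Proof. by rewrite /z /W /Defs.w /err; apply/rowP => i; rewrite !mxE; ring. Qed.

Ltac coords := apply/rowP => i; rewrite !mxE; field; lra.

(** The next four identities solve the scheme for the differences that the
    analysis uses, scaled by t_k to clear tau_k = 1/t_k. *)
Lemma gap_rec k : tp k.+1 *: gap k.+1 = (tp k.+1 - 1) *: gap k
   - (tp k.+1 * eta) *: Wh k.+1
   + ((tp k.+1 - 1) * (4 * rho + gamma)) *: (W k + err k).
Proof.
have t0 := tp_gt0 k.+1.
rewrite /gap (gfeg_x hgen) (gfeg_xbar hgen) zE hbeta tauE /Wh.
move: (W k + err k) (w_hat _ _ _ _ _) => a b.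
coords.
Qed.

Lemma x_step k : tp k.+1 *: (x k.+1 - x k) =
   - gap k - (tp k.+1 * eta) *: Wh k.+1
   + (4 * rho * (tp k.+1 - 1) - gamma) *: (W k + err k).
Proof.
have t0 := tp_gt0 k.+1.
rewrite /gap (gfeg_x hgen) zE hbeta tauE /Wh.
move: (W k + err k) (w_hat _ _ _ _ _) => a b.
coords.
Qed.

Lemma x_sub_y k : tp k.+1 *: (x k.+1 - y k) =
   (- eta) *: (tp k.+1 *: Wh k.+1 - (tp k.+1 - 1) *: (W k + err k)).
Proof.
have t0 := tp_gt0 k.+1.
rewrite (gfeg_x hgen) (gfeg_y hgen) zE hbeta heta_hat tauE /Wh.
move: (W k + err k) (w_hat _ _ _ _ _) => a b.
coords.
Qed.

Lemma y_step k : tp k.+1 *: (y k - x k) =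
   - (gap k + ((tp k.+1 - 1) * (eta - 4 * rho) + gamma) *: (W k + err k)).
Proof.
have t0 := tp_gt0 k.+1.
rewrite (gfeg_y hgen) zE hbeta heta_hat tauE /gap.
move: (W k + err k) => a.
coords.
Qed.

Lemma w_in_gra k : gra (op_add F T) (x k, W k).
Proof. by exists (xi k) => //; exact: gfeg_xi hgen k. Qed.

Lemma lip_sqn a b : sqn (F a - F b) <= L ^+ 2 * sqn (a - b).
Proof.
rewrite -!enorm2E -exprMn; have := hF a b.
have h0 : 0 <= enorm (F a - F b) by exact: sqrtr_ge0.
by move=> h; rewrite ler_pXn2r ?nnegrE //; exact: le_trans h.
Qed.

Let G k := sqn (F (x k.+1) - F (y k)).

Let WsubWh k : W k.+1 - Wh k.+1 = F (x k.+1) - F (y k).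
Proof.
by rewrite /W /Wh /Defs.w /w_hat /=; apply/rowP => i; rewrite !mxE; ring.
Qed.

Let lip_step k : tp k.+1 ^+ 2 * G k <=
  L ^+ 2 * eta ^+ 2 * sqn (tp k.+1 *: Wh k.+1 - (tp k.+1 - 1) *: (W k + err k)).
Proof.
rewrite -mulrA -[eta ^+ 2]sqrrN -(sqnZ (- eta)) -x_sub_y sqnZ mulrCA.
by apply: ler_wpM2l (lip_sqn _ _); rewrite sqr_ge0.
Qed.

Definition potential k := energy_weight eta rho (tp k) * sqn (W k)
  + tp k * dotp (W k) (gap k) + 2 * eta * tp k ^+ 2 * sqn (err k).

Let sig := 1 - (2 * (1 + 4 * kappa) * L ^+ 2 + 4 * kappa_hat) * eta ^+ 2.
Let sig_gt0 : 0 < sig. Proof. by rewrite /sig subr_gt0. Qed.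

Lemma potential_drop k : potential k.+1 + eta / 2 * sig * D k
  + (1 - mu) * (rho + eta / 4 * tp k) * sqn (W k)
  + 23 / 24 * eta * tp k ^+ 2 * sqn (err k)
  + (1 - mu) * dotp (W k) (gap k) <= potential k.
Proof.
have t2 := tp_ge2 k; have t0 := tp_gt0 k.+1.
apply: (@potential_drop_real _ eta rho mu gamma (tp k) (tp k.+1) _ _ _ _ _ _
  (dotp (err k) (W k))).
all: rewrite ?sqn_ge0 //; try exact: tpS.
  apply: le_trans (dotp_young (k := 1) _ _ _) _ => //.
  by rewrite mulr1 div1r; lra.
apply: one_step_energy => //; rewrite -/(D k).
- by scheme_lra.
- by have := tp_ge2 k.+1; lra.
- by rewrite ltW.
- exact: gap_rec.
- rewrite -x_step dotpZr -mulrA mulrCA; apply: ler_wpM2l; first by rewrite ltW.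
  by have := hPhi (w_in_gra k.+1) (w_in_gra k); rewrite enorm2E mulNr.
- by rewrite WsubWh; exact: lip_step.
have := hu (ltn0Sn k); rewrite /= -/(W k) -/(Wh k.+1) !enorm2E => h.
rewrite WsubWh -/(G k) /err -sqnN opprB.
have t20 : 0 <= tp k.+1 ^+ 2 by rewrite sqr_ge0.
apply: le_trans (ler_wpM2l t20 h) _.
have hD : tp k.+1 ^+ 2 * sqn (Wh k.+1 - (1 - tau k) *: W k) = D k.
  have tn0 : tp k.+1 != 0 by rewrite lt0r_neq0.
  by rewrite -sqnZ tauE scalerBr scalerA mulrBr mulr1 divff.
by rewrite mulrDr !(mulrCA (tp k.+1 ^+ 2)) hD.
Qed.

Section Solution.
Variable xs : 'rV[R]_p.
Hypothesis hxs : zer (op_add F T) xs.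

Let Cm := (1 - mu) / (2 * gamma).
Definition energy k := potential k + Cm * sqn (xbar k - xs).

Let optim k :
  - rho * sqn (W k) <= dotp (W k) (gap k) + dotp (W k) (xbar k - xs).
Proof.
rewrite -dotpDr /gap addrA subrK.
by have := hPhi (w_in_gra k) hxs; rewrite enorm2E subr0.
Qed.

Lemma energy_coercive k :
  eta / 8 * tp k ^+ 2 * sqn (W k) + 2 * eta * tp k ^+ 2 * sqn (err k)
  + sqn (xbar k - xs) / eta <= energy k.
Proof.
apply: (@energy_coercive_real _ _ _ _ _ _ _ _ _ _ (dotp (W k) (xbar k - xs))) => //.
- exact: sqn_ge0.
- exact: sqn_ge0.
rewrite -dotpZl -sqnZ; apply: dotp_young; scheme_lra.
Qed.

(** The energy may increase by the relative amount 1/(2 t_(k-1)^2), caused by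
    the inexact direction: z^k differs from w^k by [err k]. *)
Lemma energy_drop k :
  energy k.+1 + eta / 2 * sig * D k + eta / 12 * tp k * sqn (W k)
  + eta / 4 * tp k ^+ 2 * sqn (err k)
  <= (1 + 2^-1 * (tp k ^+ 2)^-1) * energy k.
Proof.
apply: (@energy_drop_real _ eta rho mu gamma (tp k) _ _ (dotp (W k) (gap k)) _ _
  (dotp (W k) (xbar k - xs)) (dotp (err k) (xbar k - xs))
  (sqn (W k + err k))) => //.
all: rewrite ?sqn_ge0 //.
- exact: potential_drop.
- apply: le_trans (energy_coercive k); rewrite lerDr.
  have e0 := ltW eta_gt0.
  move: (tp k ^+ 2) (sqr_ge0 (tp k)) (sqn_ge0 (W k)) (sqn_ge0 (err k)) => s *.
  by rewrite addr_ge0 ?mulr_ge0.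
- have -> : xbar k.+1 - xs = (xbar k - xs) + (- gamma) *: (W k + err k).
    by rewrite (gfeg_xbar hgen) zE scaleNr addrAC.
  move: (W k) (err k) (xbar k - xs) => a b c.
  by rewrite (sqnD c) sqnZ sqrrN dotpZr dotpDr (dotpC c a) (dotpC c b); ring.
- exact: sqnD_le.
- by apply: dotp_young; rewrite mulr_gt0 // exprn_gt0.
Qed.

Lemma energy_ge0 k : 0 <= energy k.
Proof.
apply: le_trans (energy_coercive k); have e0 := ltW eta_gt0.
move: (tp k ^+ 2) (sqr_ge0 (tp k)) (sqn_ge0 (W k)) (sqn_ge0 (err k))
  (sqn_ge0 (xbar k - xs)) => s *.
by rewrite !addr_ge0 ?mulr_ge0 ?invr_ge0.
Qed.

Let dissip k := eta / 2 * sig * D k + eta / 12 * tp k * sqn (W k)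
  + eta / 4 * tp k ^+ 2 * sqn (err k).

Let dissip_parts k : [/\ 0 <= eta / 2 * sig * D k,
  0 <= eta / 12 * tp k * sqn (W k) & 0 <= eta / 4 * tp k ^+ 2 * sqn (err k)].
Proof.
have e0 := ltW eta_gt0; have s0 := ltW sig_gt0; have t0 := ltW (tp_gt0 k).
move: (sig) (tp k) s0 t0 (sqn_ge0 (W k)) (sqn_ge0 (err k)) => s t s0 t0 w0 r0.
by split; rewrite ?mulr_ge0 ?sqr_ge0 ?sqn_ge0.
Qed.

Let dissip_ge0 k : 0 <= dissip k.
Proof. by have [? ? ?] := dissip_parts k; rewrite /dissip !addr_ge0. Qed.

Let sum_inv_sqr : bounded_series (fun k => 2^-1 * (tp k ^+ 2)^-1).
Proof.
by apply: bounded_seriesZ => //; exact: inv_sqr_bounded_series mu_gt0 tp_gt0 tpS.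
Qed.

Let inv_sqr_ge0 k : 0 <= 2^-1 * (tp k ^+ 2)^-1.
Proof. by rewrite mulr_ge0 ?invr_ge0 ?sqr_ge0. Qed.

Lemma energy_bounded : exists B, forall k, energy k <= B.
Proof.
apply: (discrete_gronwall energy_ge0 sum_inv_sqr) => k.
by have := energy_drop k; have := dissip_ge0 k; rewrite /dissip; lra.
Qed.

(** * Summability of the dissipated terms *)

(** Boundedness of the energy turns its relative increments into absolute
    summable ones. *)
Lemma energy_descent : cvgn energy /\ bounded_series dissip.
Proof.
have [B hB] := energy_bounded.
have B0 : 0 <= B := le_trans (energy_ge0 0) (hB 0%N).
apply: (@quasi_descent _ _ _ (fun k => B * (2^-1 * (tp k ^+ 2)^-1)) 0).
- exact: dissip_ge0.
- by move=> k; rewrite mulr_ge0.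
- exact: bounded_seriesZ.
- exact: energy_ge0.
move=> k; have := ler_wpM2l (inv_sqr_ge0 k) (hB k).
by have := energy_drop k; rewrite /dissip; lra.
Qed.

Let sumW : bounded_series (fun k => tp k * sqn (W k)).
Proof.
apply: bounded_series_le
  (bounded_seriesZ (c := 12 / eta) _ (energy_descent.2)) => [k|].
  have [h1 h2 h3] := dissip_parts k.
  rewrite (_ : tp k * _ = 12 / eta * (eta / 12 * tp k * sqn (W k))).
    apply: ler_wpM2l; first by rewrite divr_ge0 ?ltW.
    by rewrite /dissip; lra.
  by have h := eta_gt0; field; lra.
by rewrite divr_ge0 ?ltW.
Qed.

Let sumErr : bounded_series (fun k => tp k ^+ 2 * sqn (err k)).
Proof.
apply: bounded_series_le
  (bounded_seriesZ (c := 4 / eta) _ (energy_descent.2)) => [k|].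
  have [h1 h2 h3] := dissip_parts k.
  rewrite (_ : tp k ^+ 2 * _ = 4 / eta * (eta / 4 * tp k ^+ 2 * sqn (err k))).
    apply: ler_wpM2l; first by rewrite divr_ge0 ?ltW.
    by rewrite /dissip; lra.
  by have h := eta_gt0; field; lra.
by rewrite divr_ge0 ?ltW.
Qed.

Let sumD : bounded_series D.
Proof.
apply: bounded_series_le
  (bounded_seriesZ (c := 2 / (eta * sig)) _ (energy_descent.2)) => [k|].
  have [h1 h2 h3] := dissip_parts k.
  rewrite (_ : D k = 2 / (eta * sig) * (eta / 2 * sig * D k)).
    apply: ler_wpM2l; first by rewrite divr_ge0 ?mulr_ge0 ?ltW.
    by rewrite /dissip; lra.
  by have h := eta_gt0; have h' := sig_gt0; field; lra.
by rewrite divr_ge0 ?mulr_ge0 ?ltW.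
Qed.

Let tpS_le k : tp k.+1 <= 2 * tp k.
Proof. by rewrite tpS; have := tp_ge2 k; have := mu_lt; lra. Qed.

Let tpS_ge k : tp k <= tp k.+1.
Proof. by rewrite tpS; have := mu_gt0; lra. Qed.

Let corr_le k : sqn (tp k.+1 *: Wh k.+1 - (tp k.+1 - 1) *: (W k + err k)) <=
  2 * D k + 2 * (tp k ^+ 2 * sqn (err k)).
Proof.
rewrite (_ : tp k.+1 *: _ - _ = (tp k.+1 *: Wh k.+1 - (tp k.+1 - 1) *: W k)
                     + (- (tp k.+1 - 1)) *: err k); last first.
  by move: (W k) (Wh k.+1) (err k) => a c b; rewrite scalerDr scaleNr opprD addrA.
apply: (le_trans (sqnD_le _ _)); rewrite -/(D k) lerD2l sqnZ sqrrN.
apply: ler_wpM2l => //; apply: ler_wpM2r; first exact: sqn_ge0.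
have h1 : 0 <= tp k.+1 - 1 by have := tp_ge2 k.+1; lra.
have h2 : tp k.+1 - 1 <= tp k by have := mu_lt; rewrite tpS; lra.
by rewrite ler_pXn2r // nnegrE; exact: le_trans h2.
Qed.

Let sumG : bounded_series (fun k => tp k.+1 ^+ 2 * G k).
Proof.
have c0 : 0 <= L ^+ 2 * eta ^+ 2 by rewrite mulr_ge0 ?sqr_ge0.
have h := bounded_seriesD (bounded_seriesZ (ler0n R 2) sumD)
  (bounded_seriesZ (ler0n R 2) sumErr).
apply: bounded_series_le (bounded_seriesZ c0 h) => k.
exact: le_trans (lip_step k) (ler_wpM2l c0 (corr_le k)).
Qed.

Let V k := sqn (gap k).

(** t_k v^(k+1) = (t_k - 1) v^k + g with g of size t_k (|what| + |z|), so
    convexity of the squared norm gives v^(k+1) a contraction factor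
    1 - 1/t_k up to |g|^2 / t_k. *)
Let V_drop k : V k.+1 + V k / tp k.+1 <= V k + 4 * eta ^+ 2 *
  (tp k.+1 * (sqn (W k.+1) + G k + sqn (W k) + sqn (err k))).
Proof.
have t2 := tp_ge2 k.+1; set t := tp k.+1 in t2 *.
have [c0 c1] : 0 <= (t - 1) * (4 * rho + gamma) /\
    (t - 1) * (4 * rho + gamma) <= t * eta.
  have h : 0 <= 4 * rho + gamma <= eta.
    have h := eta_gt0; have h1 := gamma_gt0; have h2 := heta; have h3 := hrho.
    have h4 : 0 <= mu * eta by rewrite mulr_ge0 // ltW.
    by apply/andP; split; [lra | rewrite hgamma; lra].
  case/andP: h => h0 h1; split; first by rewrite mulr_ge0 //; lra.
  by apply: ler_pM => //; lra.
pose g := - (t * eta) *: Wh k.+1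
  + ((t - 1) * (4 * rho + gamma)) *: (W k + err k).
have hg : sqn g <= 4 * eta ^+ 2 * t ^+ 2 *
    (sqn (W k.+1) + G k + sqn (W k) + sqn (err k)).
  apply: (le_trans (sqnD_le _ _)); rewrite !sqnZ sqrrN.
  have hW : sqn (Wh k.+1) <= 2 * sqn (W k.+1) + 2 * G k.
    rewrite /G -WsubWh; move: (W k.+1) (Wh k.+1) => a b.
    by have := sqnD_le a (- (a - b)); rewrite sqnN subKr.
  have hz := sqnD_le (W k) (err k).
  have hc : ((t - 1) * (4 * rho + gamma)) ^+ 2 <= (t * eta) ^+ 2.
    by rewrite ler_pXn2r ?nnegrE //; exact: le_trans c1.
  have h1 := ler_wpM2l (sqr_ge0 (t * eta)) hW.
  have h2 := ler_wpM2l (sqr_ge0 (t * eta)) hz.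
  have h3 := ler_wpM2r (sqn_ge0 (W k + err k)) hc.
  by lra.
have hv : t *: gap k.+1 = (t - 1) *: gap k + g.
  by rewrite gap_rec -/t /g scaleNr; exact: (esym (addrA _ _ _)).
have hsq := congr1 (@sqn R p) hv.
rewrite sqnZ (sqnD _ g) sqnZ dotpZl in hsq.
have hcs : 0 <= (t - 1) * sqn (gap k - g) by rewrite mulr_ge0 ?sqn_ge0 //; lra.
rewrite (sqnD _ (- g)) sqnN dotpNr in hcs.
have tt : 0 < t by lra.
have t20 : 0 < t ^+ 2 by rewrite exprn_gt0.
rewrite -(ler_pM2l t20).
have -> : t ^+ 2 * (V k.+1 + V k / t) = t ^+ 2 * V k.+1 + t * V k by field; lra.
have h4 := ler_wpM2l (ltW tt) hg.
by rewrite /V; lra.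
Qed.

Let sumWErr : bounded_series (fun k =>
  tp k.+1 * (sqn (W k.+1) + G k + sqn (W k) + sqn (err k))).
Proof.
have h := bounded_seriesD (bounded_seriesD
  (bounded_seriesD (bounded_seriesS sumW) sumG)
  (bounded_seriesZ (ler0n _ 2) sumW)) sumErr.
apply: bounded_series_le h => k.
have hG : tp k.+1 * G k <= tp k.+1 ^+ 2 * G k.
  apply: ler_wpM2r; first exact: sqn_ge0.
  by rewrite expr2; apply: ler_peMr; have := tp_ge2 k.+1; lra.
have hW : tp k.+1 * sqn (W k) <= 2 * (tp k * sqn (W k)).
  by rewrite mulrA; apply: ler_wpM2r; [exact: sqn_ge0 | exact: tpS_le].
have hE : tp k.+1 * sqn (err k) <= tp k ^+ 2 * sqn (err k).
  apply: ler_wpM2r; first exact: sqn_ge0.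
  apply: le_trans (tpS_le k) _; rewrite expr2; apply: ler_wpM2r => //.
  exact: ltW.
by rewrite !mulrDr; lra.
Qed.

Let V_lim : cvgn V /\ bounded_series (fun k => V k / tp k.+1).
Proof.
apply: (@quasi_descent _ V (fun k => V k / tp k.+1) (fun k => 4 * eta ^+ 2 *
  (tp k.+1 * (sqn (W k.+1) + G k + sqn (W k) + sqn (err k)))) 0).
- by move=> k; rewrite divr_ge0 ?sqn_ge0 // ltW.
- move=> k; apply: mulr_ge0; first by rewrite mulr_ge0 ?sqr_ge0.
  apply: mulr_ge0; first exact: ltW.
  by do 3! [apply: addr_ge0; last exact: sqn_ge0]; exact: sqn_ge0.
- by apply: bounded_seriesZ sumWErr; rewrite mulr_ge0 ?sqr_ge0.
- by move=> k; exact: sqn_ge0.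
- exact: V_drop.
Qed.

Let tp_lin k : tp k.+1 <= mu * r * k.+1%:R.
Proof.
rewrite /tp -mulrA; apply: ler_wpM2l; first exact: ltW.
have h : 0 <= (r - 1) * k%:R.
  rewrite mulr_ge0 // subr_ge0; apply: le_trans hr.
  by rewrite lerDl divr_ge0 ?ltW.
by rewrite -natr1; lra.
Qed.

(** The contraction is only 1 - 1/t_k, but 1/t_k is not summable. *)
Lemma gap_cvg0 : V @ \oo --> (0 : R).
Proof.
have [cV sV] := V_lim.
by apply: (cvg_harmonic_weight _ _ tp_lin sV cV) => k; rewrite ?sqn_ge0.
Qed.

Let tsqn_ge0 k (a : 'rV[R]_p) : 0 <= tp k * sqn a.
Proof. by apply: mulr_ge0; [exact: ltW | exact: sqn_ge0]. Qed.

Let t2sqn_ge0 k (a : 'rV[R]_p) : 0 <= tp k ^+ 2 * sqn a.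
Proof. by apply: mulr_ge0; [exact: sqr_ge0 | exact: sqn_ge0]. Qed.

(** * The potential vanishes asymptotically *)
Let inner_le k : `|tp k * dotp (W k) (gap k)| <=
  eta / 8 * (tp k ^+ 2 * sqn (W k)) + 2 / eta * V k.
Proof.
rewrite -dotpZl -sqnZ; have e0 := eta_gt0.
have h : 0 < eta / 4 by lra.
apply: le_trans (dotp_young _ _ h) _; rewrite -/(V k).
rewrite (_ : eta / 4 / 2 = eta / 8); last by field.
by rewrite (_ : (2 * (eta / 4))^-1 = 2 / eta) //; field; lra.
Qed.

(** Adding a multiple of |v^k|^2 compensates the inner product in the
    potential and makes the sum dominate t_(k-1)^2 |w^k|^2. *)
Let P k := potential k + 2 / eta * V k.

Let P_ge_sqnW k : eta / 8 * (tp k ^+ 2 * sqn (W k)) <= P k.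
Proof.
have := inner_le k; rewrite ler_norml => /andP[h1 _].
have h2 : 0 <= (eta / 4 - 2 * rho) * (tp k ^+ 2 * sqn (W k)).
  by apply: mulr_ge0 => //; have := heta; lra.
have h3 : 0 <= rho * (tp k * sqn (W k)).
  exact: mulr_ge0.
have h4 : 0 <= eta * (tp k ^+ 2 * sqn (err k)).
  by apply: mulr_ge0 => //; exact: ltW.
by rewrite /P /potential /energy_weight; lra.
Qed.

Let P_div_le k : P k / tp k.+1 <= eta * (tp k * sqn (W k))
   + (tp k * sqn (W k) + V k / tp k.+1)
   + 2 * eta * (tp k ^+ 2 * sqn (err k)) + 2 / eta * (V k / tp k.+1).
Proof.
have t2 := tp_ge2 k; have tS := tpS_ge k; have e0 := eta_gt0.
have t0 := tp_gt0 k.+1.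
have hW := sqn_ge0 (W k); have hE := sqn_ge0 (err k).
have hV := sqn_ge0 (gap k).
have h1 : tp k * dotp (W k) (gap k) <= tp k ^+ 2 * sqn (W k) + V k.
  rewrite -dotpZl -sqnZ; apply: le_trans (ler_norm _) _.
  apply: le_trans (dotp_young (k := 1) _ _ _) _ => //.
  have := sqn_ge0 (tp k *: W k); rewrite -/(V k); have := hV; rewrite -/(V k).
  by lra.
have hst : tp k ^+ 2 * sqn (W k) <= tp k.+1 * (tp k * sqn (W k)).
  rewrite mulrA; apply: ler_wpM2r => //.
  by rewrite expr2; apply: ler_wpM2r => //; lra.
have h2 : energy_weight eta rho (tp k) * sqn (W k) <=
    tp k.+1 * (eta * (tp k * sqn (W k))).
  apply: (@le_trans _ _ (eta * (tp k ^+ 2 * sqn (W k)))).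
    rewrite mulrA; apply: ler_wpM2r => //; rewrite /energy_weight.
    have h3 : 0 <= rho * (tp k * (tp k - 1)).
      by apply: mulr_ge0 => //; apply: mulr_ge0; lra.
    have h4 : 0 <= eta * tp k ^+ 2 by rewrite mulr_ge0 ?sqr_ge0 // ltW.
    have h5 : 0 <= rho * tp k ^+ 2 by rewrite mulr_ge0 ?sqr_ge0 ?hrho.
    by lra.
  by rewrite [leRHS]mulrCA; apply: ler_wpM2l => //; exact: ltW.
have h6 : tp k ^+ 2 * sqn (err k) <= tp k.+1 * (tp k ^+ 2 * sqn (err k)).
  by apply: ler_peMl => //; lra.
have h7 := ler_wpM2l (ltW e0) h6.
rewrite ler_pdivrMr //.
have -> : (eta * (tp k * sqn (W k)) + (tp k * sqn (W k) + V k / tp k.+1) +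
   2 * eta * (tp k ^+ 2 * sqn (err k)) + 2 / eta * (V k / tp k.+1)) * tp k.+1 =
   tp k.+1 * (eta * (tp k * sqn (W k))) + (tp k.+1 * (tp k * sqn (W k)) + V k) +
   2 * (eta * (tp k.+1 * (tp k ^+ 2 * sqn (err k)))) + 2 / eta * V k.
  by field; lra.
by rewrite /P /potential; lra.
Qed.

Let sumV : bounded_series (fun k => V k / tp k.+1) := V_lim.2.

(** The potential alone loses (1 - mu) <w^k, v^k>, whose sign is unknown but
    whose size t_(k-1) |w^k|^2 + |v^k|^2 / t_k is summable. *)
Lemma potential_cvg : cvgn potential.
Proof.
have [B hB] := energy_bounded; have C0 : 0 <= Cm.
  by rewrite /Cm divr_ge0 ?mulr_ge0 ?(ltW gamma_gt0) //; have := mu_lt; lra.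
pose eps k := tp k * sqn (W k) + V k / tp k.+1.
have [] // := @quasi_descent _ potential (fun=> 0) eps (- (Cm * (eta * B))).
- move=> k; apply: addr_ge0; first exact: tsqn_ge0.
  by apply: divr_ge0; [exact: sqn_ge0 | exact: ltW].
- exact: bounded_seriesD.
- move=> k.
  have hX : sqn (xbar k - xs) <= eta * B.
    rewrite mulrC -ler_pdivrMr //; apply: le_trans (hB k).
    apply: le_trans (energy_coercive k); rewrite lerDr.
    move: (tp k ^+ 2) (sqr_ge0 (tp k)) (sqn_ge0 (W k)) (sqn_ge0 (err k)) => s *.
    by rewrite addr_ge0 ?mulr_ge0 ?(ltW eta_gt0).
  by have := energy_ge0 k; have := ler_wpM2l C0 hX; rewrite /energy; lra.
move=> k; rewrite addr0; have hQ := potential_drop k.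
have [d1 _ d3] := dissip_parts k.
have hW := sqn_ge0 (W k).
have t2 := tp_ge2 k; have m1 := mu_lt; have m0 := mu_gt0; have e0 := eta_gt0.
have h1 : 0 <= (1 - mu) * (rho + eta / 4 * tp k) * sqn (W k).
  have h : 0 <= eta / 4 * tp k by rewrite mulr_ge0; lra.
  have r0 := hrho.
  by apply: mulr_ge0 => //; apply: mulr_ge0; lra.
have h2 : - ((1 - mu) * dotp (W k) (gap k)) <= eps k.
  apply: le_trans (ler_norm _) _; rewrite normrN normrM ger0_norm; last by lra.
  apply: (@le_trans _ _ `|dotp (W k) (gap k)|); first by rewrite ler_piMl //; lra.
  apply: le_trans (dotp_young _ _ (tp_gt0 k.+1)) _.
  have h : tp k.+1 * sqn (W k) <= 2 * (tp k * sqn (W k)).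
    by rewrite mulrA; apply: ler_wpM2r => //; exact: tpS_le.
  have hv : 0 <= V k / tp k.+1.
    by apply: divr_ge0; [exact: sqn_ge0 | exact: ltW].
  have -> : (2 * tp k.+1)^-1 * sqn (gap k) = 2^-1 * (V k / tp k.+1).
    by rewrite /V; have := tp_gt0 k.+1 => ?; field; lra.
  by rewrite /eps; lra.
have h3 : 0 <= 23 / 24 * eta * tp k ^+ 2 * sqn (err k).
  by have := d3; lra.
by lra.
Qed.

(** [P] converges and [P k / t_k] is summable, so its limit is 0. *)
Lemma sqn_w_cvg0 : (fun k => tp k ^+ 2 * sqn (W k)) @ \oo --> (0 : R).
Proof.
have e0 := eta_gt0.
have P0 k : 0 <= P k.
  apply: le_trans (P_ge_sqnW k); apply: mulr_ge0; first by lra.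
  exact: t2sqn_ge0.
have cP : cvgn P.
  apply: is_cvgD; first exact: potential_cvg.
  by apply: is_cvgM; [exact: is_cvg_cst | exact: V_lim.1].
have sP : bounded_series (fun k => P k / tp k.+1).
  apply: bounded_series_le P_div_le _.
  apply: bounded_seriesD; last first.
    by apply: bounded_seriesZ sumV; rewrite divr_ge0 // ltW.
  apply: bounded_seriesD.
    apply: bounded_seriesD; first by apply: bounded_seriesZ sumW; exact: ltW.
    exact: bounded_seriesD.
  by apply: bounded_seriesZ sumErr; rewrite mulr_ge0 // ltW.
have P_cvg0 := cvg_harmonic_weight P0 (fun k => tp_gt0 k.+1) tp_lin sP cP.
apply: cvg0_le (cvg0Z (8 / eta) P_cvg0) => k.
rewrite mulr_ge0 ?sqr_ge0 ?sqn_ge0 //=.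
rewrite -ler_pdivrMl ?divr_gt0 // invf_div; exact: P_ge_sqnW.
Qed.

Let sqnErr_cvg0 : (fun k => tp k ^+ 2 * sqn (err k)) @ \oo --> (0 : R).
Proof.
by apply: bounded_series_cvg0 sumErr => k; rewrite mulr_ge0 ?sqr_ge0 ?sqn_ge0.
Qed.

(** * Rates for the steps *)
Let y_step_le k : tp k.+1 ^+ 2 * sqn (y k - x k) <=
  2 * V k + 16 * eta ^+ 2 * (tp k ^+ 2 * sqn (W k) + tp k ^+ 2 * sqn (err k)).
Proof.
rewrite -sqnZ y_step sqnN; apply: le_trans (sqnD_le _ _) _.
rewrite -/(V k) lerD2l sqnZ.
have t2 := tp_ge2 k.+1; have tS := tpS_le k; have e0 := eta_gt0.
have g0 := gamma_gt0; have h1 := heta; have h2 := hrho; have m0 := mu_gt0.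
have h3 : 0 <= rho * (tp k.+1 - 1) by rewrite mulr_ge0 //; lra.
have gl : gamma <= eta.
  have h : 0 <= mu * eta by rewrite mulr_ge0 // ltW.
  by rewrite hgamma; lra.
have h4 : 0 <= (eta - 8 * rho) * (tp k.+1 - 1) by rewrite mulr_ge0 //; lra.
have h5 : 0 <= eta * (2 * tp k - tp k.+1) by rewrite mulr_ge0 //; lra.
set c := (tp k.+1 - 1) * (eta - 4 * rho) + gamma.
have c0 : 0 <= c by rewrite /c; lra.
have c1 : c <= 2 * eta * tp k by rewrite /c; lra.
have hc : c ^+ 2 <= (2 * eta * tp k) ^+ 2.
  by rewrite ler_pXn2r ?nnegrE //; exact: le_trans c1.
have hz := ler_wpM2l (sqr_ge0 (2 * eta * tp k)) (sqnD_le (W k) (err k)).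
have := ler_wpM2r (sqn_ge0 (W k + err k)) hc.
by lra.
Qed.

Let x_step_le k : tp k.+1 ^+ 2 * sqn (x k.+1 - x k) <=
  2 * (tp k.+1 ^+ 2 * sqn (y k - x k))
  + 4 * eta ^+ 2 * (D k + tp k ^+ 2 * sqn (err k)).
Proof.
rewrite (_ : x k.+1 - x k = (y k - x k) + (x k.+1 - y k)); last first.
  by rewrite [RHS]addrC addrA subrK.
apply: le_trans (ler_wpM2l (sqr_ge0 _) (sqnD_le _ _)) _.
have : tp k.+1 ^+ 2 * sqn (x k.+1 - y k) <=
    eta ^+ 2 * (2 * D k + 2 * (tp k ^+ 2 * sqn (err k))).
  rewrite -sqnZ x_sub_y sqnZ sqrrN.
  by apply: ler_wpM2l; [exact: sqr_ge0 | exact: corr_le].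
by lra.
Qed.

Lemma sqn_y_step_cvg0 :
  (fun k => tp k.+1 ^+ 2 * sqn (y k - x k)) @ \oo --> (0 : R).
Proof.
apply: cvg0_le (cvg0D (cvg0Z 2 gap_cvg0)
  (cvg0Z (16 * eta ^+ 2) (cvg0D sqn_w_cvg0 sqnErr_cvg0))) => k.
by rewrite y_step_le mulr_ge0 ?sqr_ge0 ?sqn_ge0.
Qed.

Let sqn_x_step_cvg0 :
  (fun k => tp k.+1 ^+ 2 * sqn (x k.+1 - x k)) @ \oo --> (0 : R).
Proof.
have D_cvg0 : D @ \oo --> (0 : R).
  by apply: bounded_series_cvg0 sumD => k; exact: sqn_ge0.
apply: cvg0_le (cvg0D (cvg0Z 2 sqn_y_step_cvg0)
  (cvg0Z (4 * eta ^+ 2) (cvg0D D_cvg0 sqnErr_cvg0))) => k.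
by rewrite x_step_le mulr_ge0 ?sqr_ge0 ?sqn_ge0.
Qed.

Let krE k : k%:R + r = tp k.+1 / mu.
Proof. by rewrite /tp -natr1; have := mu_gt0 => ?; field; lra. Qed.

Let cvg0_index_sqr (f : nat -> R) : (forall k, 0 <= f k) ->
  (fun k => tp k ^+ 2 * f k) @ \oo --> (0 : R) ->
  (fun k => k%:R ^+ 2 * f k) @ \oo --> (0 : R).
Proof.
move=> f0 hf; apply: cvg0_le (cvg0Z (mu ^+ 2)^-1 hf) => k.
rewrite mulr_ge0 ?sqr_ge0 //= mulrA; apply: ler_wpM2r => //.
have m0 := mu_gt0.
have -> : (mu ^+ 2)^-1 * tp k ^+ 2 = (k%:R + r - 1) ^+ 2.
  by rewrite /tp; field; lra.
have h : 0 <= r - 1.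
  have := hr; have : 0 <= 2 / mu by rewrite divr_ge0 // ltW.
  by lra.
have k0 := ler0n R k.
by rewrite ler_pXn2r ?nnegrE //; lra.
Qed.

Lemma cvg0_tp_unS (f : nat -> R) : (forall k, 0 <= f k) ->
  (fun k => tp k.+1 ^+ 2 * f k) @ \oo --> (0 : R) ->
  (fun k => tp k ^+ 2 * f k) @ \oo --> (0 : R).
Proof.
move=> f0; apply: cvg0_le => k; rewrite mulr_ge0 ?sqr_ge0 //=.
apply: ler_wpM2r => //; rewrite ler_pXn2r ?nnegrE ?tpS_ge //; exact: ltW.
Qed.

Lemma rates_little_o :
  [/\ (fun k => k%:R ^+ 2 * sqn (W k)) @ \oo --> (0 : R),
      (fun k => k%:R ^+ 2 * sqn (y k - x k)) @ \oo --> (0 : R)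
    & (fun k => k%:R ^+ 2 * sqn (x k.+1 - x k)) @ \oo --> (0 : R)].
Proof.
split.
- by apply: cvg0_index_sqr sqn_w_cvg0 => k; exact: sqn_ge0.
- by apply: cvg0_index_sqr (cvg0_tp_unS _ sqn_y_step_cvg0) => k; exact: sqn_ge0.
- by apply: cvg0_index_sqr (cvg0_tp_unS _ sqn_x_step_cvg0) => k; exact: sqn_ge0.
Qed.

Lemma rates_summable :
  [/\ bounded_series (fun k => (k%:R + r) ^+ 2 * sqn (F (x k.+1) - F (y k))),
      bounded_series (fun k => (k%:R + r) ^+ 2 * sqn (u k - F (x k))),
      bounded_series (fun k => (k%:R + r) * sqn (y k - x k))
    & bounded_series (fun k => (k%:R + r) * sqn (x k.+1 - x k))].
Proof.
have m0 := mu_gt0.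
have i0 : 0 <= mu^-1 by rewrite invr_ge0 ltW.
have i20 : 0 <= (mu ^+ 2)^-1 by rewrite invr_ge0 sqr_ge0.
have hWE k : (tp k ^+ 2 * sqn (W k) + tp k ^+ 2 * sqn (err k)) / tp k.+1 <=
    tp k * sqn (W k) + tp k ^+ 2 * sqn (err k).
  have tS := tpS_ge k; have t2 := tp_ge2 k.
  rewrite mulrDl; apply: lerD.
    rewrite ler_pdivrMr // [leRHS]mulrAC; apply: ler_wpM2r; first exact: sqn_ge0.
    by rewrite expr2; apply: ler_wpM2l => //; exact: ltW.
  rewrite ler_pdivrMr //; apply: ler_peMr; last by lra.
  exact: t2sqn_ge0.
have sy : bounded_series (fun k => tp k.+1 * sqn (y k - x k)).
  have e2 : 0 <= 16 * eta ^+ 2 by rewrite mulr_ge0 ?sqr_ge0.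
  have h := bounded_seriesD (bounded_seriesZ (ler0n R 2) sumV)
    (bounded_seriesZ e2 (bounded_seriesD sumW sumErr)).
  apply: bounded_series_le h => k.
  have -> : tp k.+1 * sqn (y k - x k) = tp k.+1 ^+ 2 * sqn (y k - x k) / tp k.+1.
    by have t0 := tp_gt0 k.+1; field; lra.
  apply: (@le_trans _ _ ((2 * V k + 16 * eta ^+ 2 *
    (tp k ^+ 2 * sqn (W k) + tp k ^+ 2 * sqn (err k))) / tp k.+1)).
    by apply: ler_wpM2r; [rewrite invr_ge0 ltW | exact: y_step_le].
  rewrite mulrDl -!mulrA lerD2l !mulrA -!mulrA.
  by have := ler_wpM2l e2 (hWE k); rewrite -!mulrA.
split.
- apply: bounded_series_le (bounded_seriesZ i20 sumG) => k.
  by rewrite krE expr_div_n /G; lra.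
- apply: bounded_series_le
    (bounded_seriesZ i20 (bounded_seriesZ (ler0n R 4) sumErr)) => k.
  rewrite krE expr_div_n -/(err k) mulrAC mulrC; apply: ler_wpM2l => //.
  rewrite mulrA; apply: ler_wpM2r; first exact: sqn_ge0.
  by have := tpS_le k; have := tp_ge2 k.+1; nra.
- apply: bounded_series_le (bounded_seriesZ i0 sy) => k.
  by rewrite krE; lra.
have e2 : 0 <= 4 * eta ^+ 2 by rewrite mulr_ge0 ?sqr_ge0.
have h := bounded_seriesZ i0 (bounded_seriesD (bounded_seriesZ (ler0n R 2) sy)
    (bounded_seriesZ e2 (bounded_seriesD sumD sumErr))).
apply: bounded_series_le h => k.
rewrite krE mulrAC mulrC; apply: ler_wpM2l => //.
have t0 := tp_gt0 k.+1; have t2 := tp_ge2 k.+1.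
rewrite -(ler_pM2l t0).
have hD : 0 <= D k + tp k ^+ 2 * sqn (err k).
  by apply: addr_ge0; [exact: sqn_ge0 | rewrite mulr_ge0 ?sqr_ge0 ?sqn_ge0].
have h1 := ler_wpM2l e2 hD; have := x_step_le k.
have : 4 * eta ^+ 2 * (D k + tp k ^+ 2 * sqn (err k)) <=
   tp k.+1 * (4 * eta ^+ 2 * (D k + tp k ^+ 2 * sqn (err k))).
  by apply: ler_peMl; [exact: mulr_ge0 | lra].
by lra.
Qed.

(** * Convergence of the iterates *)

(** The squared distance to a solution is, up to a factor, the energy minus the
    potential, and both converge. *)
Lemma sqn_dist_cvg : cvgn (fun k => sqn (xbar k - xs)).
Proof.
have C0 : Cm != 0.
  by rewrite /Cm mulf_neq0 ?invr_eq0 ?lt0r_neq0 ?mulr_gt0 //; have := mu_lt; lra.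
rewrite (_ : (fun _ => _) = (fun k => Cm^-1 * (energy k - potential k))); last first.
  by apply/funext => k; rewrite /energy [potential k + _]addrC addrK mulKf.
apply: is_cvgM; first exact: is_cvg_cst.
by apply: is_cvgB; [exact: energy_descent.1 | exact: potential_cvg].
Qed.

End Solution.

(** A cluster point of xbar^k is also one of x^k, and w^k -> 0 there, so the
    closed graph makes it a solution.  The distance from xbar^k to that solution
    converges and has 0 as a cluster value. *)
Lemma iterates_cvg : zer (op_add F T) !=set0 -> closed (gra T) ->
  exists xs, [/\ zer (op_add F T) xs,
    x @ \oo --> xs, y @ \oo --> xs & xbar @ \oo --> xs].
Proof.
move=> [z0 hz0] clT.
have [B hB] : exists B, forall k, sqn (xbar k - z0) <= B.
  have [B hB] := energy_bounded hz0; exists (eta * B) => k.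
  rewrite mulrC -ler_pdivrMr //; apply: le_trans (hB k).
  apply: le_trans (energy_coercive hz0 k); rewrite lerDr.
  move: (tp k ^+ 2) (sqr_ge0 (tp k)) (sqn_ge0 (W k)) (sqn_ge0 (err k)) => s *.
  by rewrite addr_ge0 ?mulr_ge0 ?(ltW eta_gt0).
have [m hm] := sqn_bounded_cluster hB.
have drop2 (f : nat -> R) : (forall k, 0 <= f k) ->
    (fun k => tp k ^+ 2 * f k) @ \oo --> (0 : R) -> f @ \oo --> (0 : R).
  move=> f0; apply: cvg0_le => k; rewrite f0 /=; apply: ler_peMl => //.
  by have := tp_ge2 k; nra.
have W0 : (fun k => sqn (W k)) @ \oo --> (0 : R).
  by apply: drop2 (sqn_w_cvg0 hz0) => k; exact: sqn_ge0.
have V0 := gap_cvg0 hz0.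
have y0 : (fun k => sqn (y k - x k)) @ \oo --> (0 : R).
  apply: drop2 => [k|]; first exact: sqn_ge0.
  apply: cvg0_tp_unS (sqn_y_step_cvg0 hz0) => k; exact: sqn_ge0.
have L20 : 0 <= L ^+ 2 by rewrite sqr_ge0.
have zm : zer (op_add F T) m.
  suff : T m (- F m) by exists (- F m) => //; rewrite subrr.
  apply: (clT (m, - F m)) => U [[U1 U2] /= [hU1 hU2] hU].
  have [e1 e10 h1] := (nbhs_sqnP _ _).1 hU1.
  have [e2 e20 h2] := (nbhs_sqnP _ _).1 hU2.
  have f20 : 0 < e2 / 4 by rewrite divr_gt0.
  (* Two parallelogram bounds and the Lipschitz estimate enlarge the squared
     distance from xbar^k to the cluster point by 4 for x^k, and by 8 L^2 for
     xi^k. *)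
  pose e := Num.min (e1 / 4) (e2 / (32 * (1 + L ^+ 2))).
  have ee0 : 0 < e by rewrite lt_min !divr_gt0 ?mulr_gt0 //; lra.
  have [N1 _ n1] := cvgr_lt _ V0 _ ee0.
  have [N2 _ n2] := cvgr_lt _ W0 _ f20.
  have [k kN hk] := hm _ (maxn N1 N2) ee0.
  have hxk : sqn (x k - m) < 4 * e.
    have -> : x k - m = gap k + (xbar k - m) by rewrite /gap addrA subrK.
    apply: le_lt_trans (sqnD_le _ _) _.
    have := n1 k (leq_trans (leq_maxl _ _) kN); rewrite /=; lra.
  exists (x k, xi k); split; first exact: gfeg_xi hgen k.
  apply: hU; split => /=.
    apply: h1; apply: lt_le_trans hxk _.
    have : e <= e1 / 4 by rewrite ge_min lexx.
    by lra.
  apply: h2.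
  have -> : xi k - - F m = W k + - (F (x k) - F m).
    by rewrite /W /Defs.w; apply/rowP => i; rewrite !mxE; ring.
  apply: le_lt_trans (sqnD_le _ _) _; rewrite sqnN.
  have hF2 := lip_sqn (x k) m.
  have hw := n2 k (leq_trans (leq_maxr _ _) kN).
  have hL : L ^+ 2 * sqn (x k - m) <= L ^+ 2 * (4 * e).
    by apply: ler_wpM2l => //; exact: ltW.
  have he : (1 + L ^+ 2) * e <= e2 / 32.
    have c8 : 0 < 32 * (1 + L ^+ 2) by lra.
    have : e <= e2 / (32 * (1 + L ^+ 2)) by rewrite ge_min lexx orbT.
    by rewrite ler_pdivlMr //; lra.
  by move: hw => /=; lra.
have X0 : (fun k => sqn (xbar k - m)) @ \oo --> (0 : R).
  have cX := sqn_dist_cvg zm.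
  rewrite -[X in _ --> X](_ : limn (fun k => sqn (xbar k - m)) = 0) //.
  apply/eqP; rewrite eq_le; apply/andP; split; last first.
    by apply: limr_ge => //; apply: nearW => k; exact: sqn_ge0.
  rewrite leNgt; apply/negP => l0.
  set l := limn _ in cX l0.
  have l2 : l / 2 < l by lra.
  have [N _ hN] := cvgr_gt _ cX _ l2.
  have l20 : 0 < l / 2 by lra.
  have [k kN hk] := hm _ N l20.
  by have := lt_trans hk (hN k kN); rewrite ltxx.
exists m.
have x0 : (fun k => sqn (x k - m)) @ \oo --> (0 : R).
  apply: cvg0_le (cvg0D (cvg0Z 2 V0) (cvg0Z 2 X0)) => k.
  rewrite sqn_ge0 /= (_ : x k - m = gap k + (xbar k - m)) ?sqnD_le //.
  by rewrite /gap addrA subrK.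
split; [by [] | exact: cvg_sqn | apply: cvg_sqn | exact: cvg_sqn].
apply: cvg0_le (cvg0D (cvg0Z 2 y0) (cvg0Z 2 x0)) => k.
rewrite sqn_ge0 /= (_ : y k - m = (y k - x k) + (x k - m)) ?sqnD_le //.
by rewrite addrA subrK.
Qed.

End Scheme.

(** * The upper bound on the step size *)

(** A zero denominator, where the bound on [eta] is infinite, is harmless: the
    left-hand side then vanishes. *)
Lemma step_size_bound (R : realType) (L kappa kappa_hat eta : R) :
  0 < eta -> 0 <= kappa -> 0 <= kappa_hat ->
  (eta%:E < eta_bar L kappa kappa_hat)%E ->
  (2 * (1 + 4 * kappa) * L ^+ 2 + 4 * kappa_hat) * eta ^+ 2 < 1.
Proof.
move=> eta0 k0 kh0; rewrite /eta_bar inver; set M := _ + _.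
have M0 : 0 <= M.
  apply: addr_ge0; last exact: mulr_ge0.
  by apply: mulr_ge0; [lra | exact: sqr_ge0].
case: eqP => [/eqP|/eqP sM].
  by rewrite sqrtr_eq0 => M1 _; rewrite (le_anti (_ : M <= 0 <= M)) ?M1 // mul0r.
have s0 : 0 < Num.sqrt M by rewrite lt_neqAle eq_sym sM sqrtr_ge0.
rewrite lte_fin -div1r ltr_pdivlMr // => h.
rewrite -[X in X * _](sqr_sqrtr M0) -exprMn mulrC expr_lt1 //.
by rewrite mulr_ge0 // ltW.
Qed.

Theorem theorem5p2 (R : realType) (p : nat)
  (F : 'rV[R]_p -> 'rV[R]_p) (T : 'rV[R]_p -> set 'rV[R]_p)
  (L rho kappa kappa_hat mu r eta gamma : R)
  (t tau eta_hat beta : nat -> R)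
  (x y xbar u xi : nat -> 'rV[R]_p)
  (hzer : zer (op_add F T) !=set0)
  (hF : lipschitz_continuous L F)
  (hrho : 0 <= rho)
  (hPhi : co_hypomonotone rho (op_add F T))
  (hkappa : 0 <= kappa) (hkappa_hat : 0 <= kappa_hat)
  (hcond : 128 * ((1 + 4 * kappa) * L ^+ 2 + 2 * kappa_hat) * rho ^+ 2 < 1)
  (hmu : 0 < mu < 1 / 2) (hr : 1 + 2 / mu <= r)
  (heta : 8 * rho < eta) (heta_bar : (eta%:E < eta_bar L kappa kappa_hat)%E)
  (hgamma : gamma = (1 - 2 * mu) * eta / 6)
  (ht : forall k, t k = mu * (k%:R + r))
  (htau : forall k, tau k = 1 / t k)
  (heta_hat : forall k, eta_hat k = eta * (1 - tau k))
  (hbeta : forall k, beta k = - gamma * tau k + 4 * rho * (1 - tau k))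
  (hgen : GFEG_plus F T x y xbar u xi eta gamma tau eta_hat beta)
  (hu : direction_bound F x y u xi kappa kappa_hat eta tau) :
  [/\ (\sum_(0 <= k <oo)
         ((k%:R + r) ^+ 2 * enorm (F (x k.+1) - F (y k)) ^+ 2)%:E < +oo)%E,
      (\sum_(0 <= k <oo)
         ((k%:R + r) ^+ 2 * enorm (u k - F (x k)) ^+ 2)%:E < +oo)%E,
      (\sum_(0 <= k <oo)
         ((k%:R + r) * enorm (y k - x k) ^+ 2)%:E < +oo)%E
    & (\sum_(0 <= k <oo)
         ((k%:R + r) * enorm (x k.+1 - x k) ^+ 2)%:E < +oo)%E] /\
  [/\ k%:R ^+ 2 * enorm (F (x k) + xi k) ^+ 2 @[k --> \oo] --> (0 : R),
      k%:R ^+ 2 * enorm (y k - x k) ^+ 2 @[k --> \oo] --> (0 : R)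
    & k%:R ^+ 2 * enorm (x k.+1 - x k) ^+ 2 @[k --> \oo] --> (0 : R)] /\
  (closed (gra T) ->
   exists xstar, [/\ zer (op_add F T) xstar,
     x @ \oo --> xstar, y @ \oo --> xstar & xbar @ \oo --> xstar]).
Proof.
have eta0 : 0 < eta by apply: le_lt_trans heta; rewrite mulr_ge0.
have hM := step_size_bound eta0 hkappa hkappa_hat heta_bar.
have htau' k : tau k = 1 / (mu * (k%:R + r)) by rewrite htau ht.
have r0 : 0 <= r.
  by apply: le_trans hr; rewrite addr_ge0 // divr_ge0 // ltW //; case/andP: hmu.
have kr0 k : 0 <= k%:R + r by rewrite addr_ge0.
have [xs hxs] := hzer.
have [s1 s2 s3 s4] := rates_summable hF hrho hPhi hkappa hkappa_hat hmu hr heta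
  hM hgamma htau' heta_hat hbeta hgen hu hxs.
have [l1 l2 l3] := rates_little_o hF hrho hPhi hkappa hkappa_hat hmu hr heta
  hM hgamma htau' heta_hat hbeta hgen hu hxs.
split; [|split].
- split; under eq_eseriesr do rewrite enorm2E; apply: bounded_series_eseries => // k;
    by rewrite mulr_ge0 ?sqr_ge0 ?sqn_ge0.
- by split; under eq_fun do rewrite enorm2E.
exact: (iterates_cvg hF hrho hPhi hkappa hkappa_hat hmu hr heta
  hM hgamma htau' heta_hat hbeta hgen hu hzer).
Qed.
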